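(* Let $d=2^{n-1}$ (so $n-1=\log d$, with $\log$ to base $2$). Apply the decomposition algorithm described in the context to the original $n$-qubit circuit that implements quantum hashing, and let $k$ be the number of applications of Decomposition 1. Then, for $k\le n-5=\log d-4$, this yields a circuit with $$3\cdot 2^{k}+2^{n}\cdot\bigl(12\cdot(n-k)-49\bigr)$$ or, equivalently, $$3\cdot 2^{k}+d\cdot\bigl(24\cdot(\log d-k)-74\bigr)$$ $CNOT$ gates.
   Context: Gates. $R_z(\theta)=\begin{pmatrix}e^{-i\theta/2}&0\\0&e^{i\theta/2}\end{pmatrix}$, $R_y(\theta)=\begin{pmatrix}\cos(\theta/2)&-\sin(\theta/2)\\ \sin(\theta/2)&\cos(\theta/2)\end{pmatrix}$; $X$ is the negation gate. $C^{m}(U)$ is the $(m+1)$-qubit gate applying the one-qubit gate $U$ to its target qubit iff all $m$ control qubits are in state $|1\rangle$. For $a\in\{y,z\}$, $UCR^{m}_a(\theta_0,\ldots,\theta_{2^m-1})=\sum_{j=0}^{2^m-1}|j\rangle\langle j|\otimes R_a(\theta_j)$ is the uniformly controlled rotation with $m$ control qubits (the first qubit being the most significant bit of $j$) and one target qubit. Quantum hashing circuit. It acts on $n$ qubits: Hadamard gates on qubits $1,\ldots,n-1$, followed by $UCR_a^{n-1}(\theta_0,\ldots,\theta_{d-1})$ with control qubits $1,\ldots,n-1$ and target qubit $n$. Here $\theta_j=4\pi s_jx/q$ with $x\in\mathbb{Z}_q$ and $S=\{s_0,\ldots,s_{d-1}\}\subseteq\mathbb{Z}_q$ an $\varepsilon$-biased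 set, i.e. $\frac1d|\sum_j e^{i2\pi s_jy/q}|\le\varepsilon$ for all $y\in\mathbb{Z}_q\setminus\{0\}$. ($a=z$ with target initialized to $|1\rangle$ gives the phase form of the hash; $a=y$ with target initialized to $|0\rangle$ gives the amplitude form.) The decomposition algorithm. (i) Recursively apply Decomposition 1 $k$ times to construct a circuit consisting of $2^k$ gates $UCR_a^{n-k-1}$ and $2^k$ $CNOT$ gates. Decomposition 1 applies the following step to each $UCR$ gate: a gate $UCR_a^{m}(\theta_0,\ldots,\theta_{2r-1})$, $r=2^{m-1}$, is replaced by the sequence: $UCR_a^{m-1}$ (on the same controls without the first one) with angles $\frac{\theta_i+\theta_{r+i}}2$; a $CNOT$ from the first control to the target; $UCR_a^{m-1}$ with angles $\frac{\theta_i-\theta_{r+i}}2$; a $CNOT$ from the first control to the target ($0\le i<r$); or by the mirrored (reversed) sequence, mirrored versions being chosen in the recursion so that adjacent equal $CNOT$s cancel. The resulting $UCR_a^{n-k-1}$ gates have controls $k+1,\ldots,n-1$ and target $n$. (ii) Apply Decomposition 2 to each of the $2^k$ gates $UCR_a^{n-k-1}$. Decomposition 2 is as follows. - Write the gate as the product, in the order of the reflected binary Gray code, of its $2^{n-k-1}$ multi-controlled rotations, so that it becomes a sequence of gates $C^{n-k-1}(R_a(\cdot))$ (all controls on $|1\rangle$), with $X$ gates on control qubits placed to switch between codewords. The codewords are grouped into $2^{n-k-2}$ consecutive pairs; inside a pair the two rotations are separated by a single $X$ gate on the last control qubit (qubit $n-1$). - In each pair with angles $\theta_1,\theta_2$,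 replace the first rotation $C^{n-k-1}(R_a(\theta_1))$ by the sequence $C^1(R_a(\theta_1/2))$, $C^{n-k-2}(X)$, $C^1(R_a(-\theta_1/2))$, $C^{n-k-2}(X)$, and the second one by the mirrored sequence $C^{n-k-2}(X)$, $C^1(R_a(-\theta_2/2))$, $C^{n-k-2}(X)$, $C^1(R_a(\theta_2/2))$. In these sequences each $C^1$ gate has control qubit $n-1$ and target $n$, and each $C^{n-k-2}(X)$ gate has controls $k+1,\ldots,n-2$ and target $n$. The two middle $C^{n-k-2}(X)$ gates of the pair cancel. - The middle fragment of each pair, consisting of $C^1(R_a(-\theta_1/2))$, $X$ on qubit $n-1$, $C^1(R_a(-\theta_2/2))$, is denoted $U_a(\theta_1,\theta_2)$ and is implemented with $2$ $CNOT$ gates and one-qubit gates. - The last $C^1(R_a)$ gate of each pair is merged with the first $C^1(R_a)$ gate of the next pair into one $C^1(R_a)$ gate; each $C^1(R_a)$ gate is implemented with $2$ $CNOT$ gates and one-qubit rotations. - Each $C^{n-k-2}(X)$ gate is implemented, with qubit $n-1$ available as an ancilla, by the known (Barenco et al.) circuit in which $C^{m}(X)$ uses $24m-52$ $CNOT$ gates (together with one-qubit gates); this count is taken as given.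
   Formalization: The formal theorem assumes k ≥ 1: for k = 0 no Decomposition 1 is applied, so step (i) leaves one UCR gate and no CNOT instead of 2^0 = 1, and the stated count is too large by exactly one (e.g. 4482 versus 4483 for n = 7). *)

(* Defs.v *)
From HB Require Import structures.
From mathcomp Require Import all_boot all_order all_algebra.
From mathcomp Require Import complex.
From mathcomp Require Import reals trigo.

Set Implicit Arguments.
Unset Strict Implicit.
Unset Printing Implicit Defensive.

Import Order.TTheory GRing.Theory Num.Theory.

Local Open Scope ring_scope.
Local Open Scope complex_scope.

Variant axis := AxisY | AxisZ.

Definition expi (R : realType) (t : R) : R[i] := cos t +i* sin t.

Definition mx2 (K : pzRingType) (u00 u01 u10 u11 : K) : 'M[K]_2 :=
  \matrix_(i, j) if i == 0 then (if j == 0 then u00 else u01)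
                 else (if j == 0 then u10 else u11).

Definition rot (R : realType) (a : axis) (th : R) : 'M[R[i]]_2 :=
  match a with
  | AxisY => mx2 (cos (th / 2))%:C (- sin (th / 2))%:C
                 (sin (th / 2))%:C (cos (th / 2))%:C
  | AxisZ => mx2 (expi (- (th / 2))) 0 0 (expi (th / 2))
  end.

Definition Xmx (R : realType) : 'M[R[i]]_2 := mx2 0 1 1 0.

Definition Hmx (R : realType) : 'M[R[i]]_2 :=
  ((Num.sqrt 2)^-1)%:C *: mx2 1 1 1 (-1).

(* Qubits are numbered from 0: the wire i : 'I_n is qubit i + 1. *)

(* [One U t]: the one-qubit gate U on t.
   [CNOT c t]: control c, target t.
   [CRot a cs t th]: C^m(R_a(th)) with the m = size cs controls cs.
   [CX cs t]: C^m(X) with the m = size cs controls cs.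
   [UA a c t th1 th2]: U_a(th1, th2), with control c.
   [UCR a cs t th]: UCR_a^m(th 0, ..., th (2^m - 1)), m = size cs; the head of
   cs is the most significant control and th is only used below 2^m. *)
Inductive gate (R : realType) (n : nat) : Type :=
| One of 'M[R[i]]_2 & 'I_n
| CNOT of 'I_n & 'I_n
| CRot of axis & seq 'I_n & 'I_n & R
| CX of seq 'I_n & 'I_n
| UA of axis & 'I_n & 'I_n & R & R
| UCR of axis & seq 'I_n & 'I_n & (nat -> R).
Arguments One {R n}.
Arguments CNOT {R n}.
Arguments CRot {R n}.
Arguments CX {R n}.
Arguments UA {R n}.
Arguments UCR {R n}.

(* The head of the list acts first. *)
Definition circuit (R : realType) (n : nat) := seq (gate R n).

Definition bits (n : nat) := {ffun 'I_n -> bool}.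

Definition state (R : realType) (n : nat) := {ffun bits n -> R[i]}.

Definition set_bit (n : nat) (b : bits n) (t : 'I_n) (v : bool) : bits n :=
  [ffun i => if i == t then v else b i].

Definition ket (v : bool) : 'I_2 := if v then 1 else 0.

(* Apply to t a one-qubit operator U b selected by the basis state b; for all
   gates below U b depends only on the controls. *)
Definition select_apply (R : realType) (n : nat)
    (U : bits n -> 'M[R[i]]_2) (t : 'I_n) (psi : state R n) : state R n :=
  [ffun b => \sum_(v : bool) U b (ket (b t)) (ket v) * psi (set_bit b t v)].

Definition ctrl (R : realType) (n : nat) (cs : seq 'I_n) (U : 'M[R[i]]_2)
  (b : bits n) : 'M[R[i]]_2 := if all b cs then U else 1%:M.

Definition bin_val (w : seq bool) : nat :=
  foldl (fun v (b : bool) => (v.*2 + b)%N) 0%N w.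

Definition act (R : realType) (n : nat) (g : gate R n) (psi : state R n) :
    state R n :=
  match g with
  | One U t => select_apply (fun=> U) t psi
  | CNOT c t => select_apply (ctrl [:: c] (Xmx R)) t psi
  | CRot a cs t th => select_apply (ctrl cs (rot a th)) t psi
  | CX cs t => select_apply (ctrl cs (Xmx R)) t psi
  | UA a c t th1 th2 =>
      select_apply (ctrl [:: c] (rot a (- (th2 / 2)))) t
        (select_apply (fun=> Xmx R) c
          (select_apply (ctrl [:: c] (rot a (- (th1 / 2)))) t psi))
  | UCR a cs t th => select_apply (fun b => rot a (th (bin_val (map b cs)))) t psi
  end.

Definition run (R : realType) (n : nat) (c : circuit R n) (psi : state R n) :
  state R n := foldl (fun phi g => act g phi) psi c.

Definition elementary (R : realType) (n : nat) (g : gate R n) : bool :=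
  match g with
  | One U _ => U \is unitarymx
  | CNOT c t => c != t
  | _ => false
  end.

Definition is_cnot (R : realType) (n : nat) (g : gate R n) : bool :=
  if g is CNOT _ _ then true else false.

Definition cnot_count (R : realType) (n : nat) (c : circuit R n) : nat :=
  count (@is_cnot R n) c.

Definition wires (R : realType) (n : nat) (g : gate R n) : seq 'I_n :=
  match g with
  | One _ t => [:: t]
  | CNOT c t => [:: c; t]
  | CRot _ cs t _ => rcons cs t
  | CX cs t => rcons cs t
  | UA _ c t _ _ => [:: c; t]
  | UCR _ cs t _ => rcons cs t
  end.

Definition eps_biased (R : realType) (q d : nat) (eps : R)
    (s : d.-tuple 'I_q) : Prop :=
  uniq s /\
  forall y : 'I_q, (y != 0 :> nat)%N ->
    d%:R^-1 * `|\sum_(j < d) expi (2 * pi * (tnth s j)%:R * y%:R / q%:R : R)|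
      <= eps%:C.

(* theta_j = 4 pi s_j x / q, computed with representatives in [0, q); another
   choice changes theta_j by a multiple of 4 pi, hence not rot a theta_j. *)
Definition hash_angle (R : realType) (q d : nat) (s : d.-tuple 'I_q)
    (x : 'I_q) (j : nat) : R :=
  4 * pi * (nth 0%N (map val s) j)%:R * x%:R / q%:R.

Definition hash_controls (m : nat) : seq 'I_m.+1 :=
  [seq widen_ord (leqnSn m) i | i <- enum 'I_m].

(* The target is the last wire. Its initial state (|1> for the phase form, |0>
   for the amplitude form) is part of the input, not of the circuit. *)
Definition hash_circuit (R : realType) (m q d : nat) (a : axis)
    (s : d.-tuple 'I_q) (x : 'I_q) : circuit R m.+1 :=
  [seq One (Hmx R) i | i <- hash_controls m] ++
  [:: UCR a (hash_controls m) ord_max (hash_angle R s x)].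

Definition dec1_gate (R : realType) (n : nat) (mirrored : bool) (a : axis)
    (c : 'I_n) (cs : seq 'I_n) (t : 'I_n) (th : nat -> R) : circuit R n :=
  let r := (2 ^ size cs)%N in
  let p := [:: UCR a cs t (fun i => (th i + th (r + i)%N) / 2);
               CNOT c t;
               UCR a cs t (fun i => (th i - th (r + i)%N) / 2);
               CNOT c t] in
  if mirrored then rev p else p.

(* Replace each UCR gate that has a control; successive ones are replaced
   alternately by the plain and by the mirrored sequence. *)
Fixpoint dec1_pass (R : realType) (n : nat) (mirrored : bool)
    (C : circuit R n) : circuit R n :=
  match C with
  | [::] => [::]
  | UCR a (c :: cs) t th :: C' =>
      dec1_gate mirrored a c cs t th ++ dec1_pass (~~ mirrored) C'
  | g :: C' => g :: dec1_pass mirrored C'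
  end.

(* Remove CNOT c t from the maximal run of CNOTs with target t at the head of
   the circuit (these gates commute), if it occurs there. *)
Fixpoint absorb_cnot (R : realType) (n : nat) (c t : 'I_n) (C : circuit R n) :
    option (circuit R n) :=
  match C with
  | CNOT c' t' :: C' =>
      if t' == t then
        if c' == c then Some C'
        else omap (cons (CNOT c' t')) (absorb_cnot c t C')
      else None
  | _ => None
  end.

Fixpoint cancel_cnots (R : realType) (n : nat) (C : circuit R n) :
    circuit R n :=
  match C with
  | [::] => [::]
  | CNOT c t :: C' =>
      let D := cancel_cnots C' in odflt (CNOT c t :: D) (absorb_cnot c t D)
  | g :: C' => g :: cancel_cnots C'
  end.

Definition dec1 (R : realType) (n k : nat) (C : circuit R n) : circuit R n :=
  iter k (fun D => cancel_cnots (dec1_pass false D)) C.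

(* The reflected binary Gray code, most significant bit first. *)
Fixpoint gray (m : nat) : seq (seq bool) :=
  match m with
  | 0 => [:: [::]]
  | m'.+1 => map (cons false) (gray m') ++ map (cons true) (rev (gray m'))
  end.

(* The X gates switching the controls cs from codeword w to codeword w'. A
   gate with all controls on |1> realizes the codeword w once X has been
   applied to the controls where w has a 0, i.e. after
   flips cs (nseq (size cs) true) w. *)
Definition flips (R : realType) (n : nat) (cs : seq 'I_n) (w w' : seq bool) :
    circuit R n :=
  [seq One (Xmx R) p.1 | p <- zip cs (zip w w') & p.2.1 != p.2.2].

(* The gate UCR a (rcons front c) t th after the replacement of each pair of
   rotations, the cancellation of the two middle CX gates of the pair and the
   merging of the one-control rotations. ws is the list of the remaining
   codewords, cur the current codeword and phi the angle of the last C^1(R_a)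
   gate of the preceding pair (0 before the first pair), which is merged with
   the first C^1(R_a) gate of the next pair. The X gate that switches between
   the two codewords of a pair is part of UA. *)
Fixpoint dec2_pairs (R : realType) (n : nat) (a : axis) (front : seq 'I_n)
    (c t : 'I_n) (th : nat -> R) (cur : seq bool) (phi : R)
    (ws : seq (seq bool)) : circuit R n :=
  match ws with
  | w1 :: w2 :: ws' =>
      let th1 := th (bin_val w1) in
      let th2 := th (bin_val w2) in
      flips R (rcons front c) cur w1 ++
      [:: CRot a [:: c] t (phi + th1 / 2);
          CX front t;
          UA a c t th1 th2;
          CX front t] ++
      dec2_pairs a front c t th w2 (th2 / 2) ws'
  | _ =>
      CRot a [:: c] t phi ::
      flips R (rcons front c) cur (nseq (size front).+1 true)
  end.

Definition dec2_gate (R : realType) (n : nat) (a : axis) (front : seq 'I_n)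
    (c t : 'I_n) (th : nat -> R) : circuit R n :=
  let m := (size front).+1 in
  dec2_pairs a front c t th (nseq m true) 0 (gray m).

(* mcx cs t anc is an implementation of C^m(X) with controls cs and target t
   that uses anc as an ancilla. *)
Definition implement (R : realType) (n : nat)
    (mcx : seq 'I_n -> 'I_n -> 'I_n -> circuit R n) (anc : 'I_n)
    (g : gate R n) : circuit R n :=
  match g with
  | CRot a [:: c] t th =>
      [:: One (rot a (th / 2)) t; CNOT c t;
          One (rot a (- (th / 2))) t; CNOT c t]
  | UA a c t th1 th2 =>
      [:: One (rot a (- ((th1 + th2) / 4))) t; CNOT c t;
          One (rot a ((th1 - th2) / 4)) t; CNOT c t; One (Xmx R) c]
  | CX cs t => mcx cs t anc
  | _ => [:: g]
  end.

Definition dec2 (R : realType) (n : nat)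
    (mcx : seq 'I_n -> 'I_n -> 'I_n -> circuit R n) (C : circuit R n) :
    circuit R n :=
  flatten [seq match g with
               | UCR a (c0 :: cs) t th =>
                   let c := last c0 cs in
                   flatten (map (implement mcx c)
                                (dec2_gate a (belast c0 cs) c t th))
               | _ => [:: g]
               end | g <- C].

Definition decomposition (R : realType) (n : nat)
    (mcx : seq 'I_n -> 'I_n -> 'I_n -> circuit R n) (k : nat)
    (C : circuit R n) : circuit R n := dec2 mcx (dec1 k C).

(* The known construction of C^m(X) with 24 m - 52 CNOT gates and one ancilla
   in an arbitrary state. For m <= 2 the expression 24 m - 52 is negative; the
   algorithm only needs m >= 3. *)
Definition known_mcx (R : realType) (n : nat)
    (mcx : seq 'I_n -> 'I_n -> 'I_n -> circuit R n) : Prop :=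
  forall (cs : seq 'I_n) (t anc : 'I_n),
    uniq (anc :: t :: cs) -> (3 <= size cs)%N ->
    [/\ all (@elementary R n) (mcx cs t anc),
        all (fun g => all [in anc :: t :: cs] (wires g)) (mcx cs t anc),
        forall psi : state R n, run (mcx cs t anc) psi = act (CX cs t) psi
      & cnot_count (mcx cs t anc) = (24 * size cs - 52)%N].

(* Main.v *)
From mathcomp Require Import all_boot all_order all_algebra.
From mathcomp Require Import complex.
From mathcomp Require Import reals trigo.
From mathcomp Require Import ring zify.
(* Last, so that [rot] is the rotation gate and not the one of seq.v. *)
Require Import Defs.

(* Every gate of the construction with target t acts on t, conditionally on the
   other wires, by an element X^e R_a(th) of the group generated by X and the
   rotations about the axis a, in which X R_a(th) X = R_a(-th); X gates on
   control wires only relabel the basis states. So every replacement reduces to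
   an identity between angles in that group, checked for each value of the
   controls.

   Along the Gray code the last bit changes inside each pair and is kept from
   each pair to the next; this is why the C^1(R_a) gate pending after a pair
   commutes with the X gates that follow and merges with the first C^1(R_a) gate
   of the next pair.

   After the j-th application of Decomposition 1 (j >= 1) the circuit alternates
   2^j UCR gates with 2^j CNOT gates: one CNOT cancels where a plain sequence
   meets a mirrored one, since CNOTs with a common target commute. Each
   remaining UCR gate has m - k controls (n = m + 1) and 2^(m-k-1) pairs, hence
   2 + 2^(m-k-1) (4 + 2 (24 (m-k-1) - 52)) CNOT gates, and the total follows. *)

Set Implicit Arguments.
Unset Strict Implicit.
Unset Printing Implicit Defensive.

Import Order.TTheory GRing.Theory Num.Theory.

Local Open Scope ring_scope.
Local Open Scope complex_scope.
Local Open Scope sesquilinear_scope.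

#[local] Arguments run : simpl never.
#[local] Arguments act : simpl never.

(** * Matrices of the one-qubit gates *)

Lemma mulmx2 (K : pzRingType) (a b c d a' b' c' d' : K) :
  mx2 a b c d *m mx2 a' b' c' d' =
  mx2 (a * a' + b * c') (a * b' + b * d') (c * a' + d * c') (c * b' + d * d').
Proof.
apply/matrixP=> i j; rewrite !mxE !big_ord_recl big_ord0 !mxE addr0 /=.
by case: (i == 0); case: (j == 0).
Qed.

Lemma mx2_1 (K : pzRingType) : mx2 1 0 0 1 = 1%:M :> 'M[K]_2.
Proof.
apply/matrixP=> i j; rewrite !mxE.
by case: i j => [[|[|//]] ?] [[|[|//]] ?].
Qed.

Lemma expiD (R : realType) (x y : R) : expi (x + y) = expi x * expi y.
Proof.
rewrite /expi cosD sinD; apply/eqP.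
by rewrite eq_complex /= addrC eqxx addrC eqxx.
Qed.

Lemma rotD (R : realType) a (x y : R) : rot a x *m rot a y = rot a (x + y).
Proof.
case: a; rewrite /rot mulmx2 mulrDl.
  by congr mx2; rewrite ?cosD ?sinD -!rmorphM -rmorphD; congr (_%:C); ring.
by rewrite !(mul0r, mulr0, addr0, add0r) -!expiD opprD.
Qed.

Lemma rot0 (R : realType) a : rot a (0 : R) = 1%:M.
Proof. by case: a; rewrite /rot /expi mul0r ?oppr0 cos0 sin0 ?oppr0 mx2_1. Qed.

Lemma Xmx_rot (R : realType) a (x : R) : Xmx R *m rot a x = rot a (- x) *m Xmx R.
Proof.
by case: a; rewrite /rot !mulmx2 !(mul0r, mulr0, mul1r, mulr1, addr0, add0r);
  rewrite ?mulNr ?cosN ?sinN ?opprK.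
Qed.

Lemma Xmx_sqr (R : realType) : Xmx R *m Xmx R = 1%:M.
Proof. by rewrite mulmx2 !(mul0r, mulr0, mul1r, addr0, add0r) mx2_1. Qed.

Lemma mx2_adj (R : realType) (u00 u01 u10 u11 : R[i]) :
  (mx2 u00 u01 u10 u11)^t* = mx2 (u00^*) (u10^*) (u01^*) (u11^*).
Proof. by apply/matrixP=> i j; rewrite !mxE; case: (i == 0); case: (j == 0). Qed.

(** The adjoint of [rot a x] is [rot a (- x)], which is its inverse by [rotD] and [rot0]. *)
Lemma rot_unitary (R : realType) a (x : R) : rot a x \is unitarymx.
Proof.
apply/unitarymxP; rewrite -(rot0 R a) -(subrr x) -rotD; congr (_ *m _).
case: a; rewrite /rot mx2_adj mulNr ?cosN ?sinN ?opprK.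
  by congr mx2; apply/eqP; rewrite eq_complex /= ?oppr0 ?opprK !eqxx.
by rewrite rmorph0; congr mx2; apply/eqP; rewrite eq_complex /= ?cosN ?sinN ?opprK !eqxx.
Qed.

Lemma Xmx_unitary (R : realType) : Xmx R \is unitarymx.
Proof. by apply/unitarymxP; rewrite mx2_adj !rmorph0 !rmorph1 Xmx_sqr. Qed.

Lemma Hmx_sqr (R : realType) : Hmx R *m Hmx R = 1%:M.
Proof.
have two_sqrt : Num.sqrt 2 * Num.sqrt 2 = 2 :> R by rewrite -expr2 sqr_sqrtr.
rewrite /Hmx -scalemxAl -scalemxAr mulmx2 scalerA -rmorphM -invfM two_sqrt.
have half2 : (2^-1)%:C * (1 + 1) = 1 :> R[i].
  by rewrite -(rmorph1 (real_complex R)) -rmorphD -rmorphM mulVf ?pnatr_eq0.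
apply/matrixP=> i j; rewrite -mx2_1 !mxE; case: (i == 0); case: (j == 0).
all: by rewrite !(mulr1, mul1r, mulrN, mulNr) ?opprK ?subrr ?addNr ?mulr0 ?half2.
Qed.

Lemma Hmx_unitary (R : realType) : Hmx R \is unitarymx.
Proof.
apply/unitarymxP; rewrite -[RHS](Hmx_sqr R); congr (_ *m _).
apply/matrixP=> i j; rewrite !mxE.
case: (i == 0); case: (j == 0); apply/eqP.
all: by rewrite eq_complex /= !(mulr0, mul0r, addr0, oppr0) !eqxx.
Qed.

Definition dih (R : realType) (a : axis) (e : bool) (th : R) : 'M[R[i]]_2 :=
  (if e then Xmx R else 1%:M) *m rot a th.

(** The factor with index 1 acts first; moving its X to the left past [rot a x2] changes the sign of
    [x2]. *)
Lemma dihM (R : realType) a e1 e2 (x1 x2 : R) :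
  dih a e2 x2 *m dih a e1 x1 =
  dih a (e1 (+) e2) (x1 + (-1) ^+ e1 * x2).
Proof.
rewrite /dih; case: e1; last by rewrite mul1mx -mulmxA rotD addrC mul1r.
rewrite mulmxA -(mulmxA _ _ (Xmx R)) -[x2 in rot a x2]opprK -Xmx_rot mulN1r.
case: e2 => /=; last by rewrite !mul1mx -mulmxA rotD addrC.
by rewrite mulmxA Xmx_sqr !mul1mx rotD addrC.
Qed.

(** * Gates with a fixed target, and relabelling of basis states *)

Section Target.
Variables (R : realType) (n : nat).
Implicit Types (b : bits n) (t c : 'I_n) (psi : state R n).

Lemma set_bit_id b t v : set_bit b t v t = v.
Proof. by rewrite ffunE eqxx. Qed.

Lemma set_bit_neq b t v c : c != t -> set_bit b t v c = b c.
Proof. by rewrite ffunE => /negPf->. Qed.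

Lemma set_bitK b t v v' : set_bit (set_bit b t v) t v' = set_bit b t v'.
Proof. by apply/ffunP=> i; rewrite !ffunE; case: eqP. Qed.

Definition indep T t (f : bits n -> T) := forall b v, f (set_bit b t v) = f b.

(** The normal form of the gates with target [t] in both decompositions; sequences of them collapse
    by [dsel_comp]. *)
Definition dsel a t (e : bits n -> bool) (th : bits n -> R) :=
  select_apply (fun b => dih a (e b) (th b)) t.

Lemma select_applyE (U : bits n -> 'M[R[i]]_2) t psi b :
  select_apply U t psi b =
  U b (ket (b t)) 1 * psi (set_bit b t true) +
  U b (ket (b t)) 0 * psi (set_bit b t false).
Proof. by rewrite ffunE big_bool. Qed.

(** [U] is read at basis states whose bit [t] has been overwritten; independence of [t] makes these
    readings equal to [U b], which leaves a product of 2 x 2 matrices. *)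
Lemma select_apply_comp (U V : bits n -> 'M[R[i]]_2) t psi : indep t U ->
  select_apply V t (select_apply U t psi) =
  select_apply (fun b => V b *m U b) t psi.
Proof.
move=> indU; apply/ffunP=> b.
rewrite !select_applyE !set_bitK !set_bit_id !indU !mxE !big_ord_recl !big_ord0.
have -> : lift ord0 ord0 = 1 :> 'I_2 by apply/val_inj.
rewrite /ket; ring.
Qed.

Lemma dsel_comp a t (e1 e2 : bits n -> bool) (th1 th2 : bits n -> R) psi :
  indep t e1 -> indep t th1 ->
  dsel a t e2 th2 (dsel a t e1 th1 psi) =
  dsel a t (fun b => e1 b (+) e2 b)
    (fun b => th1 b + (-1) ^+ e1 b * th2 b) psi.
Proof.
move=> ind1 ind2; rewrite /dsel select_apply_comp; last by move=> b v; rewrite ind1 ind2.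
by apply/ffunP=> b; rewrite !select_applyE dihM.
Qed.

Lemma eq_dsel a t (e1 e2 : bits n -> bool) (th1 th2 : bits n -> R) psi :
  e1 =1 e2 -> th1 =1 th2 -> dsel a t e1 th1 psi = dsel a t e2 th2 psi.
Proof.
by move=> e12 th12; apply/ffunP=> b; rewrite !ffunE e12 th12.
Qed.

Lemma act_rot a t th psi :
  act (One (rot a th) t) psi = dsel a t (fun=> false) (fun=> th) psi.
Proof. by apply/ffunP=> b; rewrite !ffunE /dih mul1mx. Qed.

Lemma act_CX a cs t psi :
  act (CX cs t) psi = dsel a t (fun b => all b cs) (fun=> 0) psi.
Proof. by apply/ffunP=> b; rewrite !ffunE /dih rot0 mulmx1. Qed.

Lemma act_CNOT a c t psi :
  act (CNOT c t) psi = dsel a t (fun b => b c) (fun=> 0) psi.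
Proof. by apply/ffunP=> b; rewrite !ffunE /dih rot0 mulmx1 /ctrl /= andbT. Qed.

Lemma act_CRot1 a c t th psi :
  act (CRot a [:: c] t th) psi =
  dsel a t (fun=> false) (fun b => if b c then th else 0) psi.
Proof.
apply/ffunP=> b; rewrite !ffunE /dih /ctrl /= andbT mul1mx.
by case: (b c); rewrite ?rot0.
Qed.

Lemma act_UCR a cs t th psi :
  act (UCR a cs t th) psi =
  dsel a t (fun=> false) (fun b => th (bin_val (map b cs))) psi.
Proof. by apply/ffunP=> b; rewrite !ffunE /dih mul1mx. Qed.

Definition relabel (f : bits n -> bits n) psi : state R n :=
  [ffun b => psi (f b)].

Lemma relabel_comp f g psi : relabel f (relabel g psi) = relabel (g \o f) psi.
Proof. by apply/ffunP=> b; rewrite !ffunE. Qed.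

Lemma eq_relabel f g psi : f =1 g -> relabel f psi = relabel g psi.
Proof. by move=> fg; apply/ffunP=> b; rewrite !ffunE fg. Qed.

(** Serves to carry X gates on controls past a gate with target [t], which then reads its controls
    through [f]. *)
Lemma dsel_relabel a t e th f psi :
    involutive f -> (forall b v, f (set_bit b t v) = set_bit (f b) t v) ->
    (forall b, f b t = b t) ->
  dsel a t e th (relabel f psi) = relabel f (dsel a t (e \o f) (th \o f) psi).
Proof.
move=> fK fset ft; apply/ffunP=> b; rewrite !ffunE; apply: eq_bigr => v _.
by rewrite ffunE fset /= fK ft.
Qed.

Lemma act_X c psi :
  act (One (Xmx R) c) psi = relabel (fun b => set_bit b c (~~ b c)) psi.
Proof.
apply/ffunP=> b; rewrite !ffunE big_bool /= !mxE.
by case: (b c); rewrite !(mul0r, mul1r, add0r, addr0).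
Qed.

End Target.

(** * The Gray code as a sequence of pairs *)

Section GrayCode.

(** Extends codewords at the last bit, whereas [gray] recurses on the first. The starting bit
    alternates because the last bit is kept from one pair to the next. *)
Fixpoint snoc_pairs (v : bool) (gs : seq (seq bool)) : seq (seq bool) :=
  if gs is g :: gs' then
    rcons g v :: rcons g (~~ v) :: snoc_pairs (~~ v) gs'
  else [::].

Lemma snoc_pairs_cat v gs1 gs2 :
  snoc_pairs v (gs1 ++ gs2) =
  snoc_pairs v gs1 ++ snoc_pairs (odd (size gs1) (+) v) gs2.
Proof.
by elim: gs1 v => //= g gs1 IH v; rewrite IH addbN addNb.
Qed.

Lemma map_cons_snoc_pairs x v gs :
  map (cons x) (snoc_pairs v gs) = snoc_pairs v (map (cons x) gs).
Proof. by elim: gs v => //= g gs IH v; rewrite IH. Qed.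

(** Each pair toggles the last bit once, so the parity of the number of pairs gives the bit on which
    the list ends, where the reversed list starts. *)
Lemma rev_snoc_pairs v gs :
  rev (snoc_pairs v gs) = snoc_pairs (odd (size gs) (+) v) (rev gs).
Proof.
elim: gs v => //= g gs IH v.
by rewrite !rev_cons IH -[rcons (rev gs) g]cats1 snoc_pairs_cat size_rev /=
  -!cats1 -catA; case: (odd _); case: v.
Qed.

(** Induction along the reflection: the bit with which the reversed half starts, by
    [rev_snoc_pairs], is the one that [snoc_pairs_cat] requires after the first half. *)
Lemma gray_snoc_pairs m : gray m.+1 = snoc_pairs false (gray m).
Proof.
elim: m => [//|m IH].
have graySE l : gray l.+1 =
    map (cons false) (gray l) ++ map (cons true) (rev (gray l)) by [].
rewrite [in RHS]graySE snoc_pairs_cat graySE IH rev_snoc_pairs !map_cons_snoc_pairs.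
by rewrite size_map.
Qed.

Lemma size_gray m : size (gray m) = (2 ^ m)%N.
Proof.
elim: m => //= m IH.
by rewrite size_cat !size_map size_rev IH expnS mul2n addnn.
Qed.

Lemma size_mem_gray m w : w \in gray m -> size w = m.
Proof.
elim: m w => [|m IH] w /=; first by rewrite inE => /eqP->.
by rewrite mem_cat => /orP[] /mapP[w']; rewrite ?mem_rev => /IH <- ->.
Qed.

(** Each word occurs exactly once in the code, so for each value of the controls exactly one
    multi-controlled rotation acts. The first bit of [w] selects the half that contains it. *)
Lemma sum_gray (V : nmodType) m (f : seq bool -> V) w : size w = m ->
  \sum_(g <- gray m) (if w == g then f g else 0) = f w.
Proof.
elim: m f w => [|m IH] f [|v w] //=.
  by rewrite big_seq1.
move=> [sw]; have revE (F : seq bool -> V) :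
    \sum_(g <- rev (gray m)) F g = \sum_(g <- gray m) F g.
  by apply: perm_big; rewrite perm_rev.
rewrite big_cat !big_map /= revE.
case: v; [rewrite big1 ?add0r | rewrite addrC big1 ?add0r] => [|g _||g _] //;
  rewrite -(IH (fun g => f (_ :: g)) w sw); apply: eq_bigr => g _;
  by rewrite eqseq_cons eqxx.
Qed.

End GrayCode.

(** * X gates on the controls *)

Section Flips.
Variables (R : realType) (n : nat).
Implicit Types (b : bits n) (t c : 'I_n) (psi : state R n).

(** The effect of the X gates in place when the current codeword is [w]. The default [true] leaves
    the wires outside [cs] alone. *)
Definition mask (cs : seq 'I_n) (w : seq bool) b : bits n :=
  [ffun i => b i (+) ~~ nth true w (index i cs)].

Lemma maskK cs w : involutive (mask cs w).
Proof. by move=> b; apply/ffunP=> i; rewrite !ffunE addbK. Qed.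

Lemma mask_notin cs w b t : size w = size cs -> t \notin cs -> mask cs w b t = b t.
Proof.
move=> sw tcs; rewrite ffunE nth_default ?addbF //.
by rewrite sw leqNgt index_mem.
Qed.

Lemma mask_set_bit cs w b t v : size w = size cs -> t \notin cs ->
  mask cs w (set_bit b t v) = set_bit (mask cs w b) t v.
Proof.
move=> sw tcs; apply/ffunP=> i; rewrite [RHS]ffunE; case: (eqVneq i t) => [->|it].
  by rewrite mask_notin // set_bit_id.
by rewrite !ffunE (negPf it).
Qed.

Lemma mask_true cs psi : relabel (mask cs (nseq (size cs) true)) psi = psi.
Proof.
apply/ffunP=> b; rewrite ffunE; congr (psi _); apply/ffunP=> i.
by rewrite ffunE nth_nseq if_same addbF.
Qed.

Lemma mask_rcons_last front c g v b :
    c \notin front -> size g = size front ->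
  mask (rcons front c) (rcons g v) b c = (b c == v).
Proof.
move=> cf sg; rewrite ffunE -(cats1 front) index_cat (negPf cf) /= eqxx addn0.
by rewrite nth_rcons sg ltnn eqxx; case: (b c); case: v.
Qed.

(** Between the X gates in place, a [CX] gate with controls [front] thus fires on the prefix [g],
    for both codewords of a pair. *)
Lemma all_mask_rcons front c g v b :
    uniq front -> size g = size front ->
  all (mask (rcons front c) (rcons g v) b) front = (map b front == g).
Proof.
move=> uf sg.
have maskE i : i \in front ->
    mask (rcons front c) (rcons g v) b i = (b i == nth true g (index i front)).
  move=> fi; rewrite ffunE -(cats1 front) index_cat fi nth_rcons sg index_mem fi.
  by case: (b i); case: (nth _ _ _).
apply/idP/eqP => [/allP bg|bg].
  apply: (@eq_from_nth _ true) => [|i]; rewrite size_map // => lt_i.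
  have fi : nth c front i \in front by apply: mem_nth.
  rewrite (nth_map c) //; move: (bg _ fi).
  by rewrite maskE // index_uniq // => /eqP.
apply/allP=> i fi; rewrite maskE // -bg (nth_map c) ?index_mem // nth_index //.
Qed.

Lemma dsel_mask a t e th cs w psi : size w = size cs -> t \notin cs ->
  dsel a t e th (relabel (mask cs w) psi) =
  relabel (mask cs w) (dsel a t (e \o mask cs w) (th \o mask cs w) psi).
Proof.
by move=> sw tcs; apply: dsel_relabel => [|b v|b]; rewrite ?mask_set_bit ?mask_notin //;
  apply: maskK.
Qed.

Lemma run_cat (C1 C2 : circuit R n) psi :
  run (C1 ++ C2) psi = run C2 (run C1 psi).
Proof. exact: foldl_cat. Qed.

Lemma run_cons g (C : circuit R n) psi : run (g :: C) psi = run C (act g psi).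
Proof. by []. Qed.

Lemma run_flips cs w w' psi :
    uniq cs -> size w = size cs -> size w' = size cs ->
  run (flips R cs w w') (relabel (mask cs w) psi) = relabel (mask cs w') psi.
Proof.
move=> ucs sw sw'.
(* The flips alone, on an arbitrary state, toggle the wires where [w] and [w'] differ; this form
   passes through the induction on [cs], and composing it with the mask of [w] cancels [w]. *)
pose diff cs w w' b : bits n :=
  [ffun i => b i (+) (nth true w (index i cs) (+) nth true w' (index i cs))].
have runE phi : run (flips R cs w w') phi = relabel (diff cs w w') phi.
  elim: cs w w' ucs sw sw' phi => [|c cs IH] [|v w] [|v' w'] //=.
    move=> _ _ _ phi; apply/ffunP=> b; rewrite ffunE; congr (phi _).
    by apply/ffunP=> i; rewrite ffunE addbF.
  move=> /andP[ccs ucs] [sw] [sw'] phi.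
  have -> : flips R (c :: cs) (v :: w) (v' :: w') =
      (if v != v' then [:: One (Xmx R) c] else [::]) ++ flips R cs w w'.
    by rewrite /flips /=; case: eqP.
  have dc b : diff cs w w' b c = b c.
    rewrite ffunE !nth_default ?addbF // ?sw ?sw' leqNgt index_mem //.
  rewrite run_cat IH //; case: (eqVneq v v') => [->|vv'].
    apply: eq_relabel => b; apply/ffunP=> i; rewrite [RHS]ffunE /=.
    by case: eqP => [<-|_] /=; rewrite ?dc ?addbb ?addbF // ffunE.
  rewrite run_cons act_X relabel_comp.
  apply: eq_relabel => b; apply/ffunP=> i; rewrite [RHS]ffunE /=.
  rewrite [LHS]ffunE eq_sym; case: eqP => [<-|_] /=; last by rewrite ffunE.
  by rewrite dc; case: v v' vv' (b c) => [] [] // _ [].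
rewrite runE relabel_comp; apply: eq_relabel => b; apply/ffunP=> i.
by rewrite !ffunE; do 2!case: (nth _ _ _); case: (b i).
Qed.

Lemma act_X_mask front c g v psi : c \notin front -> size g = size front ->
  act (One (Xmx R) c) (relabel (mask (rcons front c) (rcons g v)) psi) =
  relabel (mask (rcons front c) (rcons g (~~ v))) psi.
Proof.
move=> cf sg; rewrite act_X relabel_comp; apply: eq_relabel => b.
apply/ffunP=> i; case: (eqVneq i c) => [->|ic].
  rewrite mask_rcons_last //= mask_rcons_last // set_bit_id.
  by case: (b c); case: v.
rewrite [LHS]ffunE [RHS]ffunE set_bit_neq // !nth_rcons -(cats1 front) index_cat sg.
case: (boolP (i \in front)) => fi; first by rewrite index_mem fi.
by rewrite /= eq_sym (negPf ic) ltnNge leq_addr /= gtn_eqF // addn1.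
Qed.

Lemma map_set_bit b t v cs : t \notin cs -> map (set_bit b t v) cs = map b cs.
Proof.
move=> tcs; apply/eq_in_map => i ics; rewrite set_bit_neq //.
by apply: contraNneq tcs => <-.
Qed.

End Flips.

(** * Decomposition 2 of one UCR gate *)

Section Decomposition2.
Variables (R : realType) (n : nat).
Implicit Types (t c : 'I_n) (front cs : seq 'I_n) (psi : state R n).

Lemma uniq_anc_first c t front :
  uniq (t :: rcons front c) = uniq [:: c, t & front].
Proof. by rewrite -rcons_cons rcons_uniq. Qed.

Lemma act_UA a c t (th1 th2 : R) psi :
  act (UA a c t th1 th2) psi =
  act (CRot a [:: c] t (- (th2 / 2)))
    (act (One (Xmx R) c) (act (CRot a [:: c] t (- (th1 / 2))) psi)).
Proof. by []. Qed.

(** The invariant has the X gates of the current codeword in place and a rotation by [phi] pending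
    on the last bit [vcur]. The disjunction is what permits merging it with the first rotation of
    the next pair. In a pair, the half angles add up if [front] reads [g], since the [CX] gates
    reverse the sign of the middle ones, and cancel otherwise. *)
Lemma run_dec2_pairs a front c t th gs v gcur vcur phi psi :
    uniq (t :: rcons front c) ->
    size gcur = size front -> all (fun g => size g == size front) gs ->
    phi = 0 \/ vcur = v ->
  run (dec2_pairs a front c t th (rcons gcur vcur) phi (snoc_pairs v gs))
    (relabel (mask (rcons front c) (rcons gcur vcur)) psi) =
  dsel a t (fun=> false) (fun b => (if b c == vcur then phi else 0) +
     \sum_(g <- gs) (if map b front == g then th (bin_val (rcons g (b c))) else 0))
    psi.
Proof.
move=> /[dup] utfc; rewrite cons_uniq rcons_uniq => /andP[tfc /andP[cf uf]].
have ct : c != t by apply: contraNneq tfc => <-; rewrite mem_rcons mem_head.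
have tf : t \notin front by apply: contra tfc => tf; rewrite mem_rcons inE tf orbT.
have szr g x : size g = size front -> size (rcons g x) = size (rcons front c).
  by rewrite !size_rcons => ->.
elim: gs v gcur vcur phi psi => [|g gs IH] v gcur vcur phi psi scur.
  move=> _ _; rewrite /= run_cons act_CRot1 dsel_mask ?szr //.
  rewrite -[true :: _]/(nseq (size front).+1 true) -(size_rcons front c).
  rewrite run_flips ?rcons_uniq ?cf ?szr ?size_nseq //.
  rewrite mask_true; apply: eq_dsel => // b.
  by rewrite /= mask_rcons_last // big_nil addr0.
move=> /= /andP[/eqP sg sgs] phi0.
rewrite run_cat run_flips ?rcons_uniq ?cf ?szr // !run_cons.
rewrite act_UA !act_CRot1 !(act_CX a) !(dsel_mask, act_X_mask) ?szr //.
(* The pair leaves the last bit at [~~ v], with which the next pair starts; the pending angle is now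
   [th2 / 2]. *)
rewrite IH //; last by right.
rewrite !dsel_comp.
all: try by move=> b x; rewrite /= ?mask_rcons_last ?all_mask_rcons //
  ?set_bit_neq ?map_set_bit.
apply: eq_dsel => b; rewrite /= !all_mask_rcons //.
  by rewrite addbF addbb.
rewrite !mask_rcons_last // big_cons !(expr0, mul1r, add0r).
have -> : (if b c == vcur then phi else 0) = if b c == v then phi else 0.
  by case: phi0 => ->; rewrite ?if_same.
move: (\sum_(_ <- _) _) => S.
case: (_ == g); rewrite ?(expr0, expr1, mulN1r, mul1r);
  case: (b c); case: (v) => /=; field => //.
Qed.

Lemma run_dec2_gate a front c t th psi : uniq (t :: rcons front c) ->
  run (dec2_gate a front c t th) psi = act (UCR a (rcons front c) t th) psi.
Proof.
move=> utfc; rewrite /dec2_gate gray_snoc_pairs.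
rewrite -[psi in LHS](mask_true (rcons front c)) size_rcons.
have -> : nseq (size front).+1 true = rcons (nseq (size front) true) true.
  by rewrite -cats1 -(addn1 (size front)) nseqD.
(* The initial word ends in [true] and the code starts with last bit [false], but no rotation is
   pending yet. *)
rewrite run_dec2_pairs ?size_nseq //; last by left.
  rewrite (act_UCR _ _ _ th); apply: eq_dsel => // b.
  rewrite if_same add0r map_rcons.
  by rewrite (sum_gray (fun g => th (bin_val (rcons g (b c))))) ?size_map.
by apply/allP=> g /size_mem_gray ->.
Qed.

(** The gates that [dec2_gate] produces, where [anc] is the last control of the UCR gate; the bound
    3 comes from [known_mcx]. *)
Definition implementable (anc : 'I_n) (g : gate R n) : bool :=
  match g with
  | One U _ => U \is unitarymx
  | CRot _ cs t _ => (cs == [:: anc]) && (anc != t)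
  | CX cs t => uniq (anc :: t :: cs) && (3 <= size cs)%N
  | UA _ c t _ _ => (c == anc) && (anc != t)
  | _ => false
  end.

(** * Implementation by elementary gates, with CNOT counts *)

Section Implement.
Variable mcx : seq 'I_n -> 'I_n -> 'I_n -> circuit R n.
Hypothesis mcxP : known_mcx mcx.

Lemma implement_elementary anc g :
  implementable anc g -> all (@elementary R n) (implement mcx anc g).
Proof.
case: g => [U t|c t|a cs t th|cs t|a c t th1 th2|a cs t th] //=.
- by rewrite andbT.
- by case/andP=> /eqP-> ct /=; rewrite !rot_unitary ct.
- by case/andP=> u s; have [] := mcxP u s.
- by case/andP=> /eqP-> ct /=; rewrite !rot_unitary Xmx_unitary ct.
Qed.

Lemma run_implement anc g psi :
  implementable anc g -> run (implement mcx anc g) psi = act g psi.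
Proof.
case: g => [U t|c t|a cs t th|cs t|a c t th1 th2|a cs t th] //.
- case/andP=> /eqP-> ct; rewrite /implement !run_cons !act_rot !(act_CNOT a).
  rewrite act_CRot1 !dsel_comp; try by move=> b v; rewrite ?set_bit_neq.
  apply: eq_dsel => b; first by case: (b anc).
  by case: (b anc); rewrite /= ?(expr0, expr1); field => //.
- by case/andP=> u s; have [_ _ ->] := mcxP u s.
(* The angles -(th1 + th2)/4 and (th1 - th2)/4 have sum -th2/2, needed when the control starts at 0,
   and difference -th1/2, needed when it starts at 1. *)
- case/andP=> /eqP-> ct; rewrite /implement !run_cons !act_rot !(act_CNOT a).
  rewrite act_UA !act_CRot1 !act_X !dsel_comp; try by move=> b v; rewrite ?set_bit_neq.
  have fK : involutive (fun b : bits n => set_bit b anc (~~ b anc)).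
    move=> b; rewrite set_bit_id set_bitK negbK.
    by apply/ffunP=> i; rewrite ffunE; case: eqP => [->|].
  (* The X gate in the middle of [UA] moves to the end, which makes the second rotation controlled
     on 0. *)
  rewrite dsel_relabel //; first last.
  - by move=> b; rewrite set_bit_neq // eq_sym.
  - move=> b v; rewrite set_bit_neq //; apply/ffunP=> i; rewrite !ffunE.
    by case: (eqVneq i anc) => [->|//]; rewrite (negPf ct).
  rewrite dsel_comp; try by move=> b v; rewrite ?set_bit_neq.
  rewrite /run /=; congr relabel.
  apply: eq_dsel => b; first by case: (b anc).
  by rewrite /= set_bit_id; case: (b anc); rewrite /= ?(expr0, expr1); field => //.
Qed.

Lemma run_implement_all anc C psi : all (implementable anc) C ->
  run (flatten (map (implement mcx anc) C)) psi = run C psi.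
Proof.
elim: C psi => //= g C IH psi /andP[gP CP].
by rewrite run_cat run_implement // IH.
Qed.

Lemma implement_all_elementary anc C : all (implementable anc) C ->
  all (@elementary R n) (flatten (map (implement mcx anc) C)).
Proof.
elim: C => //= g C IH /andP[gP CP].
by rewrite all_cat implement_elementary // IH.
Qed.

Lemma implementable_flips anc cs w w' : all (implementable anc) (flips R cs w w').
Proof. by rewrite /flips all_map; apply/allP=> p _ /=; apply: Xmx_unitary. Qed.

Lemma dec2_pairs_implementable a front c t th gs v cur phi :
    uniq (t :: rcons front c) -> (3 <= size front)%N ->
  all (implementable c)
    (dec2_pairs a front c t th cur phi (snoc_pairs v gs)).
Proof.
rewrite uniq_anc_first => utf front3.
have ct : c != t by move: utf; rewrite /= inE negb_or; case/andP=> /andP[].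
elim: gs v cur phi => [|g gs IH] v cur phi.
  by rewrite /= eqxx ct implementable_flips.
rewrite [dec2_pairs _ _ _ _ _ _ _ _]/= all_cat implementable_flips.
by move: utf => /= ->; rewrite !eqxx ct front3 IH.
Qed.

Lemma cnot_count_cat (C1 C2 : circuit R n) :
  cnot_count (C1 ++ C2) = (cnot_count C1 + cnot_count C2)%N.
Proof. exact: count_cat. Qed.

Lemma cnot_count_cons g (C : circuit R n) :
  cnot_count (g :: C) = (is_cnot g + cnot_count C)%N.
Proof. by []. Qed.

Lemma cnot_count_flips anc cs w w' :
  cnot_count (flatten (map (implement mcx anc) (flips R cs w w'))) = 0%N.
Proof. by rewrite /flips; elim: [seq _ <- _ | _]. Qed.

(** The closing rotation costs 2. A pair costs 2 for its [CRot], 2 for its [UA], and two [CX]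
    gates. *)
Lemma cnot_count_dec2_pairs a front c t th gs v cur phi :
    uniq (t :: rcons front c) -> (3 <= size front)%N ->
  cnot_count (flatten (map (implement mcx c)
    (dec2_pairs a front c t th cur phi (snoc_pairs v gs)))) =
  (2 + size gs * (4 + 2 * (24 * size front - 52)))%N.
Proof.
rewrite uniq_anc_first => utf front3.
have [_ _ _ mcx_count] := mcxP utf front3.
elim: gs v cur phi => [|g gs IH] v cur phi.
  rewrite mul0n addn0.
  have := cnot_count_flips c (rcons front c) cur (nseq (size front).+1 true).
  by rewrite /cnot_count /= => ->.
rewrite /= map_cat flatten_cat cnot_count_cat cnot_count_flips /=.
rewrite !(cnot_count_cat, cnot_count_cons) mcx_count IH /=; lia.
Qed.

End Implement.

End Decomposition2.

(** * Decomposition 2 of a whole circuit *)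

Section Decomposition2Pass.
Variables (R : realType) (n : nat).
Implicit Types (t c : 'I_n) (front cs : seq 'I_n) (th : nat -> R).
Variable mcx : seq 'I_n -> 'I_n -> 'I_n -> circuit R n.
Hypothesis mcxP : known_mcx mcx.

(** One of the 4 controls becomes the ancilla, which leaves the 3 required by [known_mcx]. *)
Definition dec2_ready (g : gate R n) : bool :=
  if g is UCR _ cs t _ then uniq (t :: cs) && (4 <= size cs)%N
  else elementary g.

Lemma dec2_cat (C1 C2 : circuit R n) :
  dec2 mcx (C1 ++ C2) = dec2 mcx C1 ++ dec2 mcx C2.
Proof. by rewrite /dec2 map_cat flatten_cat. Qed.

Lemma dec2_UCR a front c t th :
  dec2 mcx [:: UCR a (rcons front c) t th] =
  flatten (map (implement mcx c) (dec2_gate a front c t th)).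
Proof.
by rewrite /dec2 /=; case: front => [|f front] /=;
  rewrite ?last_rcons ?belast_rcons cats0.
Qed.

Lemma dec2_gate_implementable a front c t (th : nat -> R) :
    uniq (t :: rcons front c) -> (3 <= size front)%N ->
  all (implementable c) (dec2_gate a front c t th).
Proof.
by move=> u s3; rewrite /dec2_gate gray_snoc_pairs dec2_pairs_implementable.
Qed.

Lemma dec2_gate_spec g : dec2_ready g ->
  all (@elementary R n) (dec2 mcx [:: g]) /\
  forall psi, run (dec2 mcx [:: g]) psi = act g psi.
Proof.
case: g => [U t|c t|a cs t th|cs t|a c t th1 th2|a cs t th] //= gP.
- by rewrite gP.
- by rewrite gP.
case/lastP: cs gP => [|front c]; first by rewrite andbF.
rewrite size_rcons ltnS => /andP[u s3]; rewrite dec2_UCR.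
have impl := dec2_gate_implementable a th u s3.
split=> [|psi]; first exact: implement_all_elementary.
by rewrite run_implement_all // run_dec2_gate.
Qed.

Lemma dec2_spec C : all dec2_ready C ->
  all (@elementary R n) (dec2 mcx C) /\
  forall psi, run (dec2 mcx C) psi = run C psi.
Proof.
elim: C => //= g C IH /andP[/dec2_gate_spec[gel grun] /IH[Cel Crun]].
rewrite -cat1s dec2_cat all_cat gel Cel; split=> // psi.
by rewrite (run_cat (dec2 _ _)) grun Crun.
Qed.

Lemma cnot_count_dec2_UCR a cs t th : uniq (t :: cs) -> (4 <= size cs)%N ->
  cnot_count (dec2 mcx [:: UCR a cs t th]) =
  (2 + 2 ^ (size cs).-1 * (4 + 2 * (24 * (size cs).-1 - 52)))%N.
Proof.
case/lastP: cs => // front c; rewrite size_rcons => u s3.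
by rewrite dec2_UCR /dec2_gate gray_snoc_pairs cnot_count_dec2_pairs // size_gray.
Qed.

End Decomposition2Pass.

(** The first control is the most significant bit: it shifts the index by the offset r of
    Decomposition 1. *)
Lemma bin_val_cons v w : bin_val (v :: w) = (v * 2 ^ size w + bin_val w)%N.
Proof.
rewrite /bin_val /= double0 add0n.
elim: w (nat_of_bool v) => [|x w IH] y /=; first by rewrite muln1 addn0.
rewrite IH [in RHS]IH expnS; lia.
Qed.

(** * Decomposition 1 and its iteration *)

Section Decomposition1.
Variables (R : realType) (n : nat) (a : axis) (t : 'I_n).
Implicit Types (c : 'I_n) (cs : seq 'I_n) (th : nat -> R) (psi : state R n).

(* The UCR gates are listed in pairs because Decomposition 1 mirrors every
   second one. *)
Definition ucr_pair : Type := ((nat -> R) * 'I_n) * ((nat -> R) * 'I_n).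

Definition alternation cs (L : seq ucr_pair) : circuit R n :=
  flatten [seq [:: UCR a cs t p.1.1; CNOT p.1.2 t; UCR a cs t p.2.1; CNOT p.2.2 t]
          | p <- L].

Definition half_sum cs th : nat -> R :=
  fun i => (th i + th (2 ^ size cs + i)%N) / 2.

Definition half_diff cs th : nat -> R :=
  fun i => (th i - th (2 ^ size cs + i)%N) / 2.

(** A plain sequence, the CNOT from [p.1.2] and a mirrored sequence; the two CNOTs from [c] around
    the middle one cancel, which leaves only that one between the two half differences. *)
Definition refine c cs (L : seq ucr_pair) : seq ucr_pair :=
  flatten [seq [:: ((half_sum cs p.1.1, c), (half_diff cs p.1.1, p.1.2));
                   ((half_diff cs p.2.1, c), (half_sum cs p.2.1, p.2.2))]
          | p <- L].

Lemma size_refine c cs L : size (refine c cs L) = (size L).*2.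
Proof. by elim: L => //= p L ->. Qed.

Lemma absorb_alternation c cs L : absorb_cnot c t (alternation cs L) = None.
Proof. by case: L. Qed.

Lemma cancel_dec1_alternation c cs L :
  cancel_cnots (dec1_pass false (alternation (c :: cs) L)) =
  alternation cs (refine c cs L).
Proof.
elim: L => //= -[[th1 c1] [th2 c2]] L /=.
rewrite /alternation -/(alternation _ _) => ->.
rewrite absorb_alternation /= !eqxx.
(* If [c = c1], three equal CNOTs meet and one remains, as in the other case. *)
by case: (eqVneq c c1) => [<-|cc1] /=; rewrite ?eqxx /= ?(eq_sym c1) ?(negPf cc1).
Qed.

(** Half sum plus half difference gives the angle for first control 0, their difference the one for
    1. Each half of the pair alone is off by the cancelled CNOT, so the pair is the unit of the
    induction. *)
Lemma alternation_spec_pair c cs th1 c1 th2 c2 psi :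
    c != t -> t \notin cs -> c1 != t -> c2 != t ->
  run (alternation cs (refine c cs [:: ((th1, c1), (th2, c2))])) psi =
  run (alternation (c :: cs) [:: ((th1, c1), (th2, c2))]) psi.
Proof.
move=> ct tcs c1t c2t; rewrite /alternation /= !run_cons !act_UCR !(act_CNOT a).
have tccs : t \notin c :: cs by rewrite inE eq_sym negb_or ct.
rewrite !dsel_comp; try by move=> b v; rewrite ?set_bit_neq ?map_set_bit.
congr run; apply: eq_dsel => b; first by case: (b c); case: (b c1); case: (b c2).
rewrite !bin_val_cons size_map /half_sum /half_diff.
case: (b c); case: (b c1); rewrite /= ?(expr0, expr1, mul1n, mul0n, add0n); field => //.
Qed.

Definition ctrl_off_target (L : seq ucr_pair) :=
  all (fun p : ucr_pair => (p.1.2 != t) && (p.2.2 != t)) L.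

Lemma ctrl_off_target_refine c cs L :
  c != t -> ctrl_off_target L -> ctrl_off_target (refine c cs L).
Proof. by move=> ct; elim: L => //= p L IH /andP[/andP[-> ->] /IH ->]; rewrite ct. Qed.

Lemma run_alternation_refine c cs L psi :
    c != t -> t \notin cs -> ctrl_off_target L ->
  run (alternation cs (refine c cs L)) psi = run (alternation (c :: cs) L) psi.
Proof.
move=> ct tcs; elim: L psi => //= -[[th1 c1] [th2 c2]] L IH psi /=.
move=> /andP[/andP[c1t c2t] /IH {}IH].
have refineE p L' : refine c cs (p :: L') = refine c cs [:: p] ++ refine c cs L' by [].
have catE L1 L2 : alternation cs (L1 ++ L2) = alternation cs L1 ++ alternation cs L2.
  by rewrite /alternation map_cat flatten_cat.
by rewrite refineE catE (run_cat (alternation cs _)) alternation_spec_pair // IH -run_cat.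
Qed.

Lemma alternation_UCR c cs th psi : c != t -> t \notin cs ->
  run (alternation cs [:: ((half_sum cs th, c), (half_diff cs th, c))]) psi =
  act (UCR a (c :: cs) t th) psi.
Proof.
move=> ct tcs; rewrite /alternation /= !run_cons !act_UCR !(act_CNOT a).
rewrite !dsel_comp; try by move=> b v; rewrite ?set_bit_neq ?map_set_bit.
rewrite /run /=; apply: eq_dsel => b; first by case: (b c).
rewrite !bin_val_cons size_map /half_sum /half_diff.
case: (b c); rewrite /= ?(expr0, expr1, mul1n, mul0n, add0n); field => //.
Qed.

Lemma dec1_pass_ones U (hs : seq 'I_n) mirrored (C : circuit R n) :
  dec1_pass mirrored ([seq One U i | i <- hs] ++ C) =
  [seq One U i | i <- hs] ++ dec1_pass mirrored C.
Proof. by elim: hs => //= h hs ->. Qed.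

Lemma cancel_cnots_ones U (hs : seq 'I_n) (C : circuit R n) :
  cancel_cnots ([seq One U i | i <- hs] ++ C) =
  [seq One U i | i <- hs] ++ cancel_cnots C.
Proof. by elim: hs => //= h hs ->. Qed.

(** Counted from [j.+1] because without any application there is no CNOT and hence no alternation.
    The first application gives one pair of UCR gates, and each later one doubles the number of
    pairs. *)
Lemma dec1_spec U hs cs th j : uniq (t :: cs) -> (j < size cs)%N ->
  exists L, [/\ dec1 j.+1 ([seq One U i | i <- hs] ++ [:: UCR a cs t th]) =
                [seq One U i | i <- hs] ++ alternation (drop j.+1 cs) L,
                size L = (2 ^ j)%N,
                ctrl_off_target L
              & forall psi, run (alternation (drop j.+1 cs) L) psi =
                            act (UCR a cs t th) psi].
Proof.
move=> /[dup] utcs /= /andP[tcs ucs].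
have off i : (i < size cs)%N -> nth t cs i != t.
  by move=> lt_i; apply: contraNneq tcs => <-; rewrite mem_nth.
have tdrop i : t \notin drop i cs by apply: contra tcs; apply: mem_drop.
elim: j => [|j IH] lt_j.
  case: cs {utcs} tcs ucs off tdrop lt_j => // c cs _ _ off tdrop _.
  have ct := off 0%N isT; have {}tdrop := tdrop 1%N; rewrite /= drop0 in ct tdrop *.
  exists [:: ((half_sum cs th, c), (half_diff cs th, c))]; split=> //.
  - by rewrite /dec1 /= dec1_pass_ones cancel_cnots_ones.
  - by rewrite /ctrl_off_target /= ct.
  - by move=> psi; apply: alternation_UCR.
have [L [dE sL offL runL]] := IH (ltnW lt_j).
have dropE := drop_nth t lt_j.
exists (refine (nth t cs j.+1) (drop j.+2 cs) L); split.
- by rewrite [LHS]/= -/(dec1 _ _) dE dec1_pass_ones cancel_cnots_ones dropE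
    cancel_dec1_alternation.
- by rewrite size_refine sL expnS mul2n.
- by apply: ctrl_off_target_refine; rewrite ?off.
- by move=> psi; rewrite run_alternation_refine ?off // -dropE runL.
Qed.

End Decomposition1.

(** * Total count and main result *)

Lemma alternation_dec2_ready (R : realType) n (a : axis) (t : 'I_n) cs
    (L : seq (ucr_pair R n)) :
    uniq (t :: cs) -> (4 <= size cs)%N -> ctrl_off_target t L ->
  all (@dec2_ready R n) (alternation a t cs L).
Proof.
rewrite /= => u s4; elim: L => //= p L IH /andP[/andP[c1 c2] /IH].
by rewrite /alternation -/(alternation _ _ _ _) => ->; rewrite c1 c2 u s4.
Qed.

(** A pair holds two CNOTs and two UCR gates with a closing rotation each, hence the 6; doubling the
    number of Gray pairs gives [2 ^ size cs]. *)
Lemma cnot_count_dec2_alternation (R : realType) n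
    (mcx : seq 'I_n -> 'I_n -> 'I_n -> circuit R n) (a : axis) (t : 'I_n) cs
    (L : seq (ucr_pair R n)) :
    known_mcx mcx -> uniq (t :: cs) -> (4 <= size cs)%N ->
  cnot_count (dec2 mcx (alternation a t cs L)) =
  (size L * (6 + 2 ^ size cs * (4 + 2 * (24 * (size cs).-1 - 52))))%N.
Proof.
move=> mcxP u s4.
have [s1 s1E] : exists s, size cs = s.+1 by case: (size cs) s4 => // s _; exists s.
have count_ucr th := cnot_count_dec2_UCR mcxP a th u s4.
elim: L => [|p L IH]; first by rewrite mul0n.
have -> : alternation a t cs (p :: L) =
    [:: UCR a cs t p.1.1] ++ [:: CNOT p.1.2 t] ++
    [:: UCR a cs t p.2.1] ++ [:: CNOT p.2.2 t] ++ alternation a t cs L by [].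
have countD C1 C2 : cnot_count (dec2 mcx (C1 ++ C2)) =
    (cnot_count (dec2 mcx C1) + cnot_count (dec2 mcx C2))%N.
  by rewrite dec2_cat cnot_count_cat.
rewrite !countD !count_ucr IH s1E expnS /=.
rewrite /cnot_count /=; nia.
Qed.

Theorem theorem2 (R : realType) (m d k q : nat) (hd : d = (2 ^ m)%N)
    (a : axis) (eps : R) (s : d.-tuple 'I_q) (hs : eps_biased eps s)
    (x : 'I_q)
    (mcx : seq 'I_m.+1 -> 'I_m.+1 -> 'I_m.+1 -> circuit R m.+1)
    (hmcx : known_mcx mcx) :
  let n := m.+1 in
  let C := hash_circuit R m a s x in
  let D := decomposition mcx k C in
  (1 <= k)%N -> (k <= n - 5)%N ->
  [/\ all (@elementary R n) D,
      forall psi : state R n, run D psi = run C psi,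
      cnot_count D = (3 * 2 ^ k + 2 ^ n * (12 * (n - k) - 49))%N
    & cnot_count D =
        (3 * 2 ^ k + d * (24 * (trunc_log 2 d - k) - 74))%N].
Proof.
move=> n C D k_gt0 k_le.
have ut : uniq (ord_max :: hash_controls m).
  rewrite /= map_inj_uniq ?enum_uniq ?andbT; last first.
    by move=> i j /(congr1 val) /= ij; apply: val_inj.
  by apply/mapP=> -[i _ /(congr1 val) /= mi]; have := ltn_ord i; rewrite -mi ltnn.
have sz : size (hash_controls m) = m by rewrite size_map size_enum_ord.
(* For [k = 0] the first term of the count would be 2 instead of 3: a single closing rotation and no
   CNOT from Decomposition 1. *)
have [k1 k1E lt_k] : exists2 k1, k = k1.+1 & (k1 < size (hash_controls m))%N.
  by case: k k_gt0 k_le {D} => // k1 _ k_le; exists k1; rewrite // sz /n in k_le *; lia.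
have [L [dE sL offL runL]] :=
  dec1_spec a (Hmx R) (hash_controls m) (hash_angle R s x) ut lt_k.
have utk : uniq (ord_max :: drop k (hash_controls m)).
  by apply: subseq_uniq ut; rewrite /= eqxx drop_subseq.
have szk : size (drop k (hash_controls m)) = (m - k)%N by rewrite size_drop sz.
have szk4 : (4 <= size (drop k (hash_controls m)))%N by rewrite szk /n in k_le *; lia.
rewrite -k1E in dE runL.
have DE : D = dec2 mcx ([seq One (Hmx R) i | i <- hash_controls m] ++
    alternation a ord_max (drop k (hash_controls m)) L).
  by rewrite /D /decomposition /C /hash_circuit dE.
have ready : all (@dec2_ready R n) ([seq One (Hmx R) i | i <- hash_controls m] ++
    alternation a ord_max (drop k (hash_controls m)) L).
  rewrite all_cat alternation_dec2_ready // andbT all_map.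
  by apply/allP=> i _ /=; apply: Hmx_unitary.
have [Del Drun] := dec2_spec hmcx ready.
have count0 : cnot_count (dec2 mcx [seq One (Hmx R) i | i <- hash_controls m]) = 0%N.
  by elim: (hash_controls m).
have countD : cnot_count D = (3 * 2 ^ k + d * (24 * (m - k) - 74))%N.
  rewrite DE dec2_cat cnot_count_cat count0 cnot_count_dec2_alternation // sL szk.
  have -> : (d = 2 ^ k1 * (2 ^ (m - k) * 2))%N.
    by rewrite hd -expnSr -expnD; congr expn; rewrite k1E /n in k_le *; lia.
  have -> : (2 ^ k = 2 * 2 ^ k1)%N by rewrite k1E expnS.
  have : (4 <= m - k)%N by rewrite -szk.
  case: (m - k)%N => // l l4 /=.
  (* Here [l] is at least 3, so none of the truncated subtractions reaches 0. *)
  have -> : (24 * l.+1 - 74 = 24 * l - 50)%N by lia.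
  nia.
split=> //.
- by rewrite DE.
- move=> psi; rewrite DE Drun run_cat runL /C /hash_circuit run_cat.
  by [].
(* One factor 2 of [2 ^ n] goes into the bracket: 24 (m + 1 - k) - 98 = 24 (m - k) - 74. *)
- rewrite countD hd /n expnS.
  rewrite /n in k_le; nia.
- by rewrite countD hd trunc_expnK.
Qed.
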